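(* Let $\mathcal{R}$ be a commutative ring, let $\mathbf{M},\mathbf{N}$ be $\mathcal{R}$-modules, and let $a,b,c,d\in\mathcal{R}$. There is a natural isomorphism of $\mathcal{R}[H,V]$-modules $$\mathcal{F}_{\mathbf{M}}(a,b)\otimes_{\mathcal{R}}\mathcal{F}_{\mathbf{N}}(c,d)\cong\mathcal{F}^{[2]}_{\mathbf{M}\otimes\mathbf{N}}\big((a,b)\otimes(c,d)\big).$$
   Context: All tensor products are over $\mathcal{R}$. For an $\mathcal{R}$-module $\mathbf{M}$, $\mathcal{F}_{\mathbf{M}}(a,b)$ is the $\mathcal{R}$-module of sequences $(x_n)_{n\ge0}$ in $\mathbf{M}$ with $x_{n+2}=ax_{n+1}+bx_n$ for all $n\ge0$; it is an $\mathcal{R}[T]$-module with $T$ acting by the shift $(x_n)\mapsto(x_{n+1})$. For an $\mathcal{R}$-module $\mathbf{L}$, $\mathcal{F}^{[2]}_{\mathbf{L}}((a,b)\otimes(c,d))$ is the set of double Fibonacci sequences of type $(a,b)\otimes(c,d)$, i.e. double sequences $(x_{n,k})_{n,k\ge0}$ with $x_{n,k}\in\mathbf{L}$ such that for all $n,k\ge0$ $$x_{n+2,k}=a x_{n+1,k}+b x_{n,k},\qquad x_{n,k+2}=c x_{n,k+1}+d x_{n,k}.$$ It is an $\mathcal{R}[H,V]$-module with horizontal shift $H(x_{n,k})=(x_{n+1,k})$ and vertical shift $V(x_{n,k})=(x_{n,k+1})$. On $\mathcal{F}_{\mathbf{M}}(a,b)\otimes\mathcal{F}_{\mathbf{N}}(c,d)$,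 $H$ acts as the shift on the first factor and $V$ as the shift on the second factor. ''Natural'' means natural in $\mathbf{M}$ and $\mathbf{N}$. *)

(* Defs.v *)
From HB Require Import structures.
From mathcomp Require Import all_boot all_algebra.
From mathcomp Require Import boolp functions.
From mathcomp Require Import mpoly.

Set Implicit Arguments.
Unset Strict Implicit.
Unset Printing Implicit Defensive.

Import GRing.Theory.

Local Open Scope ring_scope.
Local Open Scope quotient_scope.

(* Tensor product of modules over a commutative ring, by generators and       *)
(* relations.  The sequence [:: (x1, y1); ...; (xn, yn)] stands for the       *)
(* formal sum x1 (x) y1 + ... + xn (x) yn, and scalars are absorbed by the    *)
(* left factor, so that no formal coefficients are needed.                    *)

Section Tensor.
Variables (R : comNzRingType) (M N : lmodType R).
Implicit Types (s t : seq (M * N)) (x : M) (y : N) (r : R).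

Inductive tensor_rel : seq (M * N) -> seq (M * N) -> Prop :=
| TensorRefl s : tensor_rel s s
| TensorSym s t : tensor_rel s t -> tensor_rel t s
| TensorTrans s t u : tensor_rel s t -> tensor_rel t u -> tensor_rel s u
| TensorCat s s' t t' :
    tensor_rel s s' -> tensor_rel t t' -> tensor_rel (s ++ t) (s' ++ t')
| TensorComm s t : tensor_rel (s ++ t) (t ++ s)
| TensorZero y : tensor_rel [:: (0, y)] [::]
| TensorAddl x x' y : tensor_rel [:: (x + x', y)] [:: (x, y); (x', y)]
| TensorAddr x y y' : tensor_rel [:: (x, y + y')] [:: (x, y); (x, y')]
| TensorScale r x y : tensor_rel [:: (r *: x, y)] [:: (x, r *: y)].

Definition tensor_eq : rel (seq (M * N)) := fun s t => `[< tensor_rel s t >].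

Lemma tensor_eq_equiv : equiv_class_of tensor_eq.
Proof.
split=> [s|s t|t s u]; first exact/asboolP/TensorRefl.
  by apply/asboolP/asboolP; apply: TensorSym.
by move=> /asboolP st /asboolP tu; apply/asboolP/(TensorTrans st tu).
Qed.

Canonical tensor_eq_equiv_rel := EquivRelPack tensor_eq_equiv.

Definition tensor := {eq_quot tensor_eq}.

HB.instance Definition _ := Choice.on tensor.
HB.instance Definition _ := EqQuotient.on tensor.

Lemma tensor_piP s t :
  \pi_tensor s = \pi_tensor t <-> tensor_rel s t.
Proof.
split=> [/eqP|st]; first by rewrite eqmodE => /asboolP.
by apply/eqP; rewrite eqmodE; apply/asboolP.
Qed.

Lemma tensor_rel_map (f : M -> M) s t :
    (forall x x', f (x + x') = f x + f x') ->
    (forall r x, f (r *: x) = r *: f x) ->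
  tensor_rel s t ->
  tensor_rel [seq (f p.1, p.2) | p <- s] [seq (f p.1, p.2) | p <- t].
Proof.
move=> fD fZ; elim=> {s t} /=.
- by move=> s; apply: TensorRefl.
- by move=> s t _; apply: TensorSym.
- by move=> s t u _ st _; apply: TensorTrans st.
- by move=> s s' t t' _ ss _ tt; rewrite !map_cat; apply: TensorCat.
- by move=> s t; rewrite !map_cat; apply: TensorComm.
- move=> y; suff -> : f 0 = 0 by apply: TensorZero.
  by apply: (addrI (f 0)); rewrite -fD !addr0.
- by move=> x x' y; rewrite fD; apply: TensorAddl.
- by move=> x y y'; apply: TensorAddr.
- by move=> r x y; rewrite fZ; apply: TensorScale.
Qed.

Definition tensor_add (u v : tensor) : tensor := \pi_tensor (repr u ++ repr v).
Definition tensor_opp (u : tensor) : tensor :=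
  \pi_tensor [seq (- p.1, p.2) | p <- repr u].
Definition tensor_scale r (u : tensor) : tensor :=
  \pi_tensor [seq (r *: p.1, p.2) | p <- repr u].

Lemma tensor_repr s : tensor_rel (repr (\pi_tensor s)) s.
Proof. by apply/tensor_piP; rewrite reprK. Qed.

Lemma tensor_pi_add s t :
  tensor_add (\pi_tensor s) (\pi_tensor t) = \pi_tensor (s ++ t).
Proof. by apply/tensor_piP/TensorCat; apply: tensor_repr. Qed.

Lemma tensor_pi_opp s :
  tensor_opp (\pi_tensor s) = \pi_tensor [seq (- p.1, p.2) | p <- s].
Proof.
apply/tensor_piP/(@tensor_rel_map -%R)/tensor_repr; first exact: opprD.
by move=> r x; rewrite scalerN.
Qed.

Lemma tensor_pi_scale r s :
  tensor_scale r (\pi_tensor s) = \pi_tensor [seq (r *: p.1, p.2) | p <- s].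
Proof.
apply/tensor_piP/(@tensor_rel_map ( *:%R r))/tensor_repr.
  exact: scalerDr.
by move=> r' x; rewrite !scalerA mulrC.
Qed.

Lemma tensor_ind (P : tensor -> Prop) :
  (forall s, P (\pi_tensor s)) -> forall u, P u.
Proof. by move=> Ppi u; rewrite -[u]reprK. Qed.

Lemma tensor_addA : associative tensor_add.
Proof.
elim/tensor_ind=> s; elim/tensor_ind=> t; elim/tensor_ind=> u.
by rewrite !tensor_pi_add catA.
Qed.

Lemma tensor_addC : commutative tensor_add.
Proof.
elim/tensor_ind=> s; elim/tensor_ind=> t.
by rewrite !tensor_pi_add; apply/tensor_piP/TensorComm.
Qed.

Lemma tensor_add0 : left_id (\pi_tensor [::]) tensor_add.
Proof. by elim/tensor_ind=> s; rewrite tensor_pi_add. Qed.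

Lemma tensor_addN : left_inverse (\pi_tensor [::]) tensor_opp tensor_add.
Proof.
elim/tensor_ind=> s; rewrite tensor_pi_opp tensor_pi_add; apply/tensor_piP.
elim: s => [|[x y] s IHs] /=; first exact: TensorRefl.
set s' := map _ s; rewrite -cat1s -[(x, y) :: s]cat1s.
apply: (@TensorTrans _ (([:: (- x, y)] ++ [:: (x, y)]) ++ (s' ++ s))).
  rewrite -catA; apply: TensorCat (TensorRefl _) _.
  by rewrite !catA; apply: TensorCat (TensorComm _ _) (TensorRefl _).
rewrite -[[::]]/([::] ++ [::]); apply: TensorCat IHs.
apply: TensorTrans (TensorSym (TensorAddl _ _ _)) _.
by rewrite addNr; apply: TensorZero.
Qed.

HB.instance Definition _ := GRing.isZmodule.Build tensor
  tensor_addA tensor_addC tensor_add0 tensor_addN.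

Lemma tensor_scaleA r r' u :
  tensor_scale r (tensor_scale r' u) = tensor_scale (r * r') u.
Proof.
elim/tensor_ind: u => s; rewrite !tensor_pi_scale -map_comp.
by congr (\pi_tensor _); apply: eq_map => p /=; rewrite scalerA.
Qed.

Lemma tensor_scale1 : left_id 1 tensor_scale.
Proof.
elim/tensor_ind=> s; rewrite tensor_pi_scale; congr (\pi_tensor _).
by rewrite -[RHS]map_id; apply: eq_map => -[x y]; rewrite /= scale1r.
Qed.

Lemma tensor_scaleDr : right_distributive tensor_scale +%R.
Proof.
move=> r; elim/tensor_ind=> s; elim/tensor_ind=> t.
by rewrite /+%R /= tensor_pi_add !tensor_pi_scale tensor_pi_add map_cat.
Qed.

Lemma tensor_scaleDl u : {morph tensor_scale^~ u : r r' / r + r'}.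
Proof.
elim/tensor_ind: u => s r r'.
rewrite [RHS]/+%R /= !tensor_pi_scale tensor_pi_add; apply/tensor_piP.
elim: s => [|[x y] s IHs] /=; first exact: TensorRefl.
rewrite scalerDl -cat1s.
apply: TensorTrans (TensorCat (TensorAddl _ _ _) IHs) _.
set A := map _ s; set B := map _ s.
rewrite -[X in tensor_rel X]/([:: _] ++ (([:: _] ++ A ++ B))).
rewrite -[X in tensor_rel _ X]/([:: _] ++ (A ++ ([:: _] ++ B))).
apply: TensorCat (TensorRefl _) _; rewrite !catA.
exact: TensorCat (TensorComm _ _) (TensorRefl _).
Qed.

HB.instance Definition _ := GRing.Zmodule_isLmodule.Build R tensor
  tensor_scaleA tensor_scale1 tensor_scaleDr tensor_scaleDl.

Definition pure x y : tensor := \pi_tensor [:: (x, y)].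

Lemma pure_bilinear : bilinear_for *:%R *:%R pure.
Proof.
have addE s t : \pi_tensor s + \pi_tensor t = \pi_tensor (s ++ t).
  exact: tensor_pi_add.
have scaleE r s : r *: \pi_tensor s = \pi_tensor [seq (r *: p.1, p.2) | p <- s].
  exact: tensor_pi_scale.
split=> [y r x x'|x r y y']; rewrite /pure /= scaleE addE; apply/tensor_piP => /=.
  exact: TensorAddl.
apply: TensorTrans (TensorAddr _ _ _) _.
exact: TensorCat (TensorSym (TensorScale _ _ _)) (TensorRefl [:: (x, y')]).
Qed.

HB.instance Definition _ :=
  bilinear_isBilinear.Build R M N tensor *:%R *:%R pure pure_bilinear.

Lemma tensor_pi_sum s : \pi_tensor s = \sum_(p <- s) pure p.1 p.2.
Proof.
elim: s => [|[x y] s IHs]; first by rewrite big_nil.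
by rewrite big_cons -IHs -cat1s -tensor_pi_add.
Qed.

Lemma tensorE (u : tensor) : u = \sum_(p <- repr u) pure p.1 p.2.
Proof. by rewrite -tensor_pi_sum reprK. Qed.

End Tensor.

Section TensorLift.
Variables (R : comNzRingType) (M N P : lmodType R).
Variable f : {bilinear M -> N -> P}.

Definition tensor_lift (u : tensor M N) : P :=
  \sum_(p <- repr u) f p.1 p.2.

Lemma tensor_lift_pi s :
  tensor_lift (\pi_(tensor M N) s) = \sum_(p <- s) f p.1 p.2.
Proof.
suff eq_sum t : tensor_rel t s ->
    \sum_(p <- t) f p.1 p.2 = \sum_(p <- s) f p.1 p.2.
  exact/eq_sum/tensor_repr.
elim=> {s t} //=.
- by move=> s t u _ -> _ ->.
- by move=> s s' t t' _ ss _ tt; rewrite !big_cat /= ss tt.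
- by move=> s t; rewrite !big_cat /= addrC.
- by move=> y; rewrite big_seq1 big_nil linear0l.
- by move=> x x' y; rewrite big_seq1 big_cons big_seq1 linearDl.
- by move=> x y y'; rewrite big_seq1 big_cons big_seq1 linearDr.
- by move=> r x y; rewrite !big_seq1 /= linearZl_LR linearZr_LR.
Qed.

Lemma tensor_lift_linear : linear tensor_lift.
Proof.
move=> r; elim/tensor_ind=> s; elim/tensor_ind=> t.
have -> : r *: \pi_(tensor M N) s + \pi_(tensor M N) t =
    \pi_(tensor M N) ([seq (r *: p.1, p.2) | p <- s] ++ t).
  by rewrite -[LHS]/(tensor_add (tensor_scale _ _) _)
             tensor_pi_scale tensor_pi_add.
rewrite !tensor_lift_pi big_cat big_map scaler_sumr; congr (_ + _).
by apply: eq_bigr => p _; rewrite linearZl_LR.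
Qed.

HB.instance Definition _ :=
  GRing.isLinear.Build R (tensor M N) P *:%R tensor_lift tensor_lift_linear.

Lemma tensor_liftE x y : tensor_lift (pure x y) = f x y.
Proof. by rewrite tensor_lift_pi big_seq1. Qed.

Lemma tensor_lift_uniq (g : {linear tensor M N -> P}) :
  (forall x y, g (pure x y) = f x y) -> g =1 tensor_lift.
Proof.
by move=> gE u; rewrite [u in LHS]tensorE linear_sum; apply: eq_bigr => p _.
Qed.

End TensorLift.

Section TensorMap.
Variables (R : comNzRingType) (M M' N N' : lmodType R).
Variables (f : {linear M -> M'}) (g : {linear N -> N'}).

Definition pure_map x y : tensor M' N' := pure (f x) (g y).

Lemma pure_map_bilinear : bilinear_for *:%R *:%R pure_map.
Proof.
split=> [y r x x'|x r y y']; rewrite /pure_map linearP.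
  by rewrite linearPl.
by rewrite linearPr.
Qed.

HB.instance Definition _ :=
  bilinear_isBilinear.Build R M N _ *:%R *:%R pure_map pure_map_bilinear.

Definition tensor_map : {linear tensor M N -> tensor M' N'} :=
  tensor_lift pure_map.

Lemma tensor_mapE x y : tensor_map (pure x y) = pure (f x) (g y).
Proof. exact: tensor_liftE. Qed.

End TensorMap.

Section FibonacciSequences.
Variables (R : comNzRingType) (a b : R) (M : lmodType R).

Definition is_fib (x : nat -> M) : Prop :=
  forall n, x n.+2 = a *: x n.+1 + b *: x n.

Definition fib_pred : {pred nat -> M} := fun x => `[< is_fib x >].

Lemma fib_submod_closed : submod_closed fib_pred.
Proof.
split=> [|r x y /asboolP xP /asboolP yP]; apply/asboolP => n.
  by rewrite /= !scaler0 addr0.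
rewrite -[LHS]/(r *: x _ + y _) -[in RHS]/(a *: (r *: x _ + y _) +
  b *: (r *: x _ + y _)) xP yP !scalerDr !scalerA !(mulrC r).
by rewrite addrACA.
Qed.

HB.instance Definition _ :=
  GRing.isSubmodClosed.Build R (nat -> M) fib_pred fib_submod_closed.

Record fib := Fib { fib_val :> nat -> M; fib_valP : fib_val \in fib_pred }.

HB.instance Definition _ := [isSub for fib_val].
HB.instance Definition _ := [Choice of fib by <:].
HB.instance Definition _ := [SubChoice_isSubLmodule of fib by <:].

Lemma fibP (x : fib) : is_fib x.
Proof. exact/asboolP/fib_valP. Qed.

Lemma shift_subproof (x : fib) : (fun n => x n.+1) \in fib_pred.
Proof. by apply/asboolP => n; rewrite fibP. Qed.

Definition shift (x : fib) : fib := Fib (shift_subproof x).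

Lemma shift_linear : linear shift.
Proof. by move=> r x y; apply/val_inj/funext => n. Qed.

HB.instance Definition _ := GRing.isLinear.Build R fib fib _ shift shift_linear.

End FibonacciSequences.

Section FibonacciMap.
Variables (R : comNzRingType) (a b : R) (M M' : lmodType R).
Variable f : {linear M -> M'}.

Lemma fib_map_subproof (x : fib a b M) :
  (fun n => f (x n)) \in fib_pred a b (M := M').
Proof. by apply/asboolP => n; rewrite fibP linearD !linearZ. Qed.

Definition fib_map (x : fib a b M) : fib a b M' := Fib (fib_map_subproof x).

Lemma fib_map_linear : linear fib_map.
Proof. by move=> r x y; apply/val_inj/funext => n; apply: linearP. Qed.

HB.instance Definition _ :=
  GRing.isLinear.Build R (fib a b M) (fib a b M') _ fib_map fib_map_linear.

End FibonacciMap.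

Section DoubleFibonacciSequences.
Variables (R : comNzRingType) (a b c d : R) (L : lmodType R).

Definition is_fib2 (x : nat -> nat -> L) : Prop :=
  forall n k, x n.+2 k = a *: x n.+1 k + b *: x n k /\
              x n k.+2 = c *: x n k.+1 + d *: x n k.

Definition fib2_pred : {pred nat -> nat -> L} := fun x => `[< is_fib2 x >].

Lemma fib2_submod_closed : submod_closed fib2_pred.
Proof.
split=> [|r x y /asboolP xP /asboolP yP]; apply/asboolP => n k.
  by rewrite /= !scaler0 addr0.
have combE i j : (r *: x + y) i j = r *: x i j + y i j by [].
have [xh xv] := xP n k; have [yh yv] := yP n k.
rewrite !combE xh xv yh yv !scalerDr !scalerA !(mulrC r).
by split; rewrite addrACA.
Qed.

HB.instance Definition _ :=
  GRing.isSubmodClosed.Build R (nat -> nat -> L) fib2_pred fib2_submod_closed.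

Record fib2 :=
  Fib2 { fib2_val :> nat -> nat -> L; fib2_valP : fib2_val \in fib2_pred }.

HB.instance Definition _ := [isSub for fib2_val].
HB.instance Definition _ := [Choice of fib2 by <:].
HB.instance Definition _ := [SubChoice_isSubLmodule of fib2 by <:].

Lemma fib2P (x : fib2) : is_fib2 x.
Proof. exact/asboolP/fib2_valP. Qed.

Lemma hshift_subproof (x : fib2) : (fun n k => x n.+1 k) \in fib2_pred.
Proof. by apply/asboolP => n k; apply: fib2P. Qed.

Lemma vshift_subproof (x : fib2) : (fun n k => x n k.+1) \in fib2_pred.
Proof. by apply/asboolP => n k; apply: fib2P. Qed.

Definition hshift (x : fib2) : fib2 := Fib2 (hshift_subproof x).
Definition vshift (x : fib2) : fib2 := Fib2 (vshift_subproof x).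

Lemma hshift_linear : linear hshift.
Proof. by move=> r x y; apply: val_inj. Qed.

Lemma vshift_linear : linear vshift.
Proof. by move=> r x y; apply: val_inj. Qed.

HB.instance Definition _ :=
  GRing.isLinear.Build R fib2 fib2 _ hshift hshift_linear.
HB.instance Definition _ :=
  GRing.isLinear.Build R fib2 fib2 _ vshift vshift_linear.

Lemma hvshiftC x : hshift (vshift x) = vshift (hshift x).
Proof. exact: val_inj. Qed.

End DoubleFibonacciSequences.

Section DoubleFibonacciMap.
Variables (R : comNzRingType) (a b c d : R) (L L' : lmodType R).
Variable f : {linear L -> L'}.

Lemma fib2_map_subproof (x : fib2 a b c d L) :
  (fun n k => f (x n k)) \in fib2_pred a b c d (L := L').
Proof.
apply/asboolP => n k; have [xh xv] := fib2P x n k.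
by rewrite xh xv !linearD !linearZ.
Qed.

Definition fib2_map (x : fib2 a b c d L) : fib2 a b c d L' :=
  Fib2 (fib2_map_subproof x).

Lemma fib2_map_linear : linear fib2_map.
Proof.
move=> r x y; apply/val_inj/funext => n; apply/funext => k; exact: linearP.
Qed.

HB.instance Definition _ := GRing.isLinear.Build R
  (fib2 a b c d L) (fib2 a b c d L') _ fib2_map fib2_map_linear.

End DoubleFibonacciMap.

(* The module over R[H, V] defined by an R-module L and two commuting         *)
(* endomorphisms of L: in {mpoly R[2]} the variable 'X_ord0 is H and          *)
(* 'X_ord_max is V, so that the monomial 'X_[m] is H ^ (m 0) * V ^ (m 1).     *)
(* The carrier is an alias of L, because L itself already is a module over R; *)
(* linear maps between such aliases are linear over {mpoly R[2]}.             *)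

Section PolynomialModule.
Variables (R : comNzRingType) (L : lmodType R) (H V : {linear L -> L}).
Hypothesis HVC : forall x, H (V x) = V (H x).

Definition hvmod of (forall x, H (V x) = V (H x)) : Type := L.

Local Notation hvM := (hvmod HVC).

HB.instance Definition _ := GRing.Zmodule.copy hvM L.

Implicit Types (p q : {mpoly R[2]}) (m : 'X_{1..2}) (x : L).

Definition hv_mon m x : L := iter (m ord0) H (iter (m ord_max) V x).

Definition hv_scale p (x : hvM) : hvM :=
  \sum_(m <- msupp p) p@_m *: hv_mon m x.

Lemma hv_mon_linear m : linear (hv_mon m).
Proof.
have iter_lin (f : {linear L -> L}) k : linear (iter k f).
  by move=> r x y; elim: k => //= k ->; rewrite linearP.
by move=> r x y; rewrite /hv_mon !iter_lin.
Qed.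

HB.instance Definition _ m :=
  GRing.isLinear.Build R L L _ (hv_mon m) (hv_mon_linear m).

Lemma hv_monD m m' x : hv_mon (m + m')%MM x = hv_mon m (hv_mon m' x).
Proof.
rewrite /hv_mon !mnmDE !iterD; congr (iter _ _ _).
elim: (m ord_max) => [|i IHi] //=; rewrite -IHi.
by elim: (m' ord0) => [|j IHj] //=; rewrite IHj HVC.
Qed.

Lemma hv_scale_sub p x (s : seq 'X_{1..2}) :
    uniq s -> {subset msupp p <= s} ->
  hv_scale p x = \sum_(m <- s) p@_m *: hv_mon m x.
Proof.
move=> s_uniq sub_s; rewrite /hv_scale [RHS](bigID (mem (msupp p))) /=.
rewrite [X in _ + X]big1 => [|m /memN_msupp_eq0 ->]; last by rewrite scale0r.
rewrite addr0 -[RHS]big_filter; apply: perm_big; apply: uniq_perm => //.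
  exact: filter_uniq.
by move=> m; rewrite mem_filter; case: (boolP (m \in _)) => //= /sub_s ->.
Qed.

Lemma hv_scaleDl x : {morph hv_scale^~ x : p q / p + q}.
Proof.
move=> p q /=; pose s := undup (msupp p ++ msupp q).
rewrite !(@hv_scale_sub _ x s) ?undup_uniq // => [|m|m|m].
- by rewrite -big_split; apply: eq_bigr => m _; rewrite mcoeffD scalerDl.
- by rewrite mem_undup mem_cat => ->; rewrite orbT.
- by rewrite mem_undup mem_cat => ->.
- by rewrite mem_undup; apply: msuppD_le.
Qed.

Lemma hv_scaleDr : right_distributive hv_scale +%R.
Proof.
move=> p x y; rewrite -big_split; apply: eq_bigr => m _ /=.
by rewrite linearD scalerDr.
Qed.

Lemma hv_scale_sum (I : Type) (s : seq I) (F : I -> {mpoly R[2]}) x :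
  hv_scale (\sum_(i <- s) F i) x = \sum_(i <- s) hv_scale (F i) x.
Proof.
elim: s => [|i s IHs]; last by rewrite !big_cons hv_scaleDl IHs.
by rewrite !big_nil /hv_scale msupp0 big_nil.
Qed.

Lemma hv_scaleZX r m x : hv_scale (r *: 'X_[m]) x = r *: hv_mon m x.
Proof.
rewrite (@hv_scale_sub _ _ [:: m]) // => [|m' /msuppZ_le]; last by rewrite msuppX.
by rewrite big_seq1 mcoeffZ mcoeffX eqxx mulr1.
Qed.

Lemma hv_scale1 : left_id 1 hv_scale.
Proof.
move=> x; rewrite -[1]scale1r -mpolyX0 hv_scaleZX scale1r /hv_mon.
by rewrite !mnm0E.
Qed.

Lemma hv_scaleA p q x : hv_scale p (hv_scale q x) = hv_scale (p * q) x.
Proof.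
rewrite [in RHS](mpolyE p) [in RHS](mpolyE q) mulr_suml hv_scale_sum.
apply: eq_bigr => m _; rewrite mulr_sumr hv_scale_sum [hv_scale q x]/hv_scale.
rewrite linear_sum scaler_sumr; apply: eq_bigr => m' _.
rewrite -scalerAl -scalerAr scalerA -mpolyXD hv_scaleZX hv_monD.
by rewrite linearZ /= scalerA.
Qed.

HB.instance Definition _ := GRing.Zmodule_isLmodule.Build {mpoly R[2]} hvM
  hv_scaleA hv_scale1 hv_scaleDr hv_scaleDl.

Lemma hv_scaleC r (x : hvM) : r%:MP *: x = r *: (x : L).
Proof.
rewrite -[LHS]/(hv_scale _ _) -[r%:MP]mulr1 mul_mpolyC -mpolyX0 hv_scaleZX.
by rewrite /hv_mon !mnm0E.
Qed.

Lemma hv_scaleH (x : hvM) : 'X_ord0 *: x = H x.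
Proof.
rewrite -[LHS]/(hv_scale _ _) -['X_ord0]scale1r hv_scaleZX scale1r.
by rewrite /hv_mon !mnm1E.
Qed.

Lemma hv_scaleV (x : hvM) : 'X_ord_max *: x = V x.
Proof.
rewrite -[LHS]/(hv_scale _ _) -['X_ord_max]scale1r hv_scaleZX scale1r.
by rewrite /hv_mon !mnm1E.
Qed.

End PolynomialModule.

(* In tensor_fibHV, H and V act by the shift of the left and of the right     *)
(* tensor factor; in fib2HV, by the horizontal and vertical shifts.           *)

Section FibonacciModules.
Variables (R : comNzRingType) (a b c d : R).

Section TensorOfSequences.
Variables M N : lmodType R.

Local Notation T := (tensor (fib a b M) (fib c d N)).

Definition tensor_hshift : {linear T -> T} := tensor_map (@shift R a b M) idfun.
Definition tensor_vshift : {linear T -> T} := tensor_map idfun (@shift R c d N).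

Lemma tensor_hvshiftC u :
  tensor_hshift (tensor_vshift u) = tensor_vshift (tensor_hshift u).
Proof.
rewrite [u]tensorE !linear_sum; apply: eq_bigr => p _.
by rewrite !tensor_mapE.
Qed.

Definition tensor_fibHV := hvmod tensor_hvshiftC.

HB.instance Definition _ := GRing.Lmodule.on tensor_fibHV.

End TensorOfSequences.

Section DoubleSequences.
Variable L : lmodType R.

Definition fib2HV := hvmod (@hvshiftC R a b c d L).

HB.instance Definition _ := GRing.Lmodule.on fib2HV.

End DoubleSequences.

End FibonacciModules.

(* Main.v *)
(** A Fibonacci sequence is its pair of initial terms propagated by two fixed
    scalar sequences, and a double Fibonacci sequence is determined in the same
    way by its 2 x 2 block of initial terms.  The map sending [pure x y] to the
    double sequence [pure (x n) (y k)] is therefore inverted by rebuilding a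
    tensor of sequences from that block. *)
Require Import Defs.
From HB Require Import structures.
From mathcomp Require Import all_boot all_algebra.
From mathcomp Require Import boolp functions.
From mathcomp Require Import mpoly.

Set Implicit Arguments.
Unset Strict Implicit.
Unset Printing Implicit Defensive.

Import GRing.Theory.

Local Open Scope ring_scope.

(** Every tensor is a finite sum of pure ones by [tensorE]. The later identities on tensors are
    reduced to pure tensors through this lemma. *)
Lemma tensor_linear_ext (R : comNzRingType) (M N P : lmodType R)
    (f g : {linear tensor M N -> P}) :
  (forall x y, f (pure x y) = g (pure x y)) -> f =1 g.
Proof.
by move=> fg u; rewrite [u]tensorE !linear_sum; apply: eq_bigr => p _; apply: fg.
Qed.

Section HVLinear.
Variables (R : comNzRingType) (L L' : lmodType R).
Variables (H V : {linear L -> L}) (H' V' : {linear L' -> L'}).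
Variables (HVC : forall x, H (V x) = V (H x)).
Variables (HVC' : forall x, H' (V' x) = V' (H' x)).
Variable f : {linear L -> L'}.
Hypotheses (fH : forall x, f (H x) = H' (f x)) (fV : forall x, f (V x) = V' (f x)).

(** A polynomial acts as an [R]-combination of the operators [hv_mon], so an [R]-linear map that
    intertwines [H] with [H'] and [V] with [V'] commutes with the action monomial by monomial. *)
Lemma hvmod_linear : linear (f : hvmod HVC -> hvmod HVC').
Proof.
have fE m x : f (hv_mon H V m x) = hv_mon H' V' m (f x).
  rewrite /hv_mon; elim: (m ord0) => [|i /= <- //] /=.
  by elim: (m ord_max) => [|j /= <-].
move=> p x y; rewrite [LHS](linearD f); congr (_ + _).
rewrite -[p *: x]/(hv_scale (HVC := HVC) p x) -[RHS]/(hv_scale (HVC := HVC') p _).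
rewrite /hv_scale linear_sum; apply: eq_bigr => m _.
by rewrite linearZ /= fE.
Qed.

End HVLinear.

Section FibonacciBasis.
Variables (R : comNzRingType) (a b : R).

(** The recurrence has order two, so the induction carries two consecutive terms. *)
Lemma fib_ext (M : lmodType R) (x y : fib a b M) :
  (forall i : 'I_2, x i = y i) -> x = y.
Proof.
move=> xy; apply/val_inj/funext => n /=.
suff [] : x n = y n /\ x n.+1 = y n.+1 by [].
elim: n => [|n [IH0 IH1]]; first by have := (xy ord0, xy ord_max); case.
by rewrite !fibP IH0 IH1.
Qed.

(** The scalar solutions of the recurrence with initial terms [(1, 0)] for [i = 0] and [(0, 1)] for
    [i = 1]: the coefficient of [x i] in the [n]-th term of a solution [x]. *)
Fixpoint fib_unit_seq (i n : nat) : R :=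
  if n is n1.+1 then
    if n1 is n2.+1 then a * fib_unit_seq i n1 + b * fib_unit_seq i n2
    else (i == 1%N)%:R
  else (i == 0%N)%:R.

Lemma fib_unit_seqE (i j : 'I_2) : fib_unit_seq i j = (i == j)%:R.
Proof. by case: i j => [[|[|//]] ?] [[|[|//]] ?]. Qed.

Variable M : lmodType R.

Lemma fib_prop_subproof (i : nat) (x : M) :
  (fun n => fib_unit_seq i n *: x) \in fib_pred a b (M := M).
Proof. by apply/asboolP => n; rewrite !scalerA -scalerDl. Qed.

Definition fib_prop i x : fib a b M := Fib (fib_prop_subproof i x).

Lemma fib_prop_linear i : linear (fib_prop i).
Proof.
move=> r x y; apply/val_inj/funext => n.
rewrite -[RHS]/(r *: (_ *: x) + _ *: y) /= scalerDr.
by rewrite !scalerA mulrC.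
Qed.

HB.instance Definition _ i :=
  GRing.isLinear.Build R M (fib a b M) _ (fib_prop i) (fib_prop_linear i).

(** Evaluation is given a name so that it can carry a linear structure and be moved through sums by
    [linear_sum]. *)
Definition fib_eval n (x : fib a b M) : M := x n.

Lemma fib_eval_linear n : linear (fib_eval n).
Proof. by []. Qed.

HB.instance Definition _ n :=
  GRing.isLinear.Build R (fib a b M) M _ (fib_eval n) (fib_eval_linear n).

(** By [fib_ext] only the indices 0 and 1 matter, and there the unit sequences are Kronecker
    deltas. *)
Lemma fib_decomp (x : fib a b M) : \sum_(i < 2) fib_prop i (x i) = x.
Proof.
apply: fib_ext => j; rewrite -[LHS]/(fib_eval j _) linear_sum (bigD1 j) //=.
rewrite /fib_eval /= fib_unit_seqE eqxx scale1r big1 ?addr0 // => i /negPf ij.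
by rewrite fib_unit_seqE ij scale0r.
Qed.

End FibonacciBasis.

Section TensorToDouble.
Variables (R : comNzRingType) (a b c d : R).

(** Fixing the second index gives a sequence of type [(a, b)], fixing the first one of type
    [(c, d)]. Two uses of [fib_ext] bring first [n], then [k], below 2. *)
Lemma fib2_ext (L : lmodType R) (x y : fib2 a b c d L) :
  (forall i j : 'I_2, x i j = y i j) -> x = y.
Proof.
have row (z : fib2 a b c d L) n : (fun k => z n k) \in fib_pred c d (M := L).
  by apply/asboolP => k; have [] := fib2P z n k.
have col (z : fib2 a b c d L) k : (fun n => z n k) \in fib_pred a b (M := L).
  by apply/asboolP => n; have [] := fib2P z n k.
move=> xy; apply/val_inj/funext => n; apply/funext => k /=.
suff /(congr1 (fun z : fib a b L => z n)) : Fib (col x k) = Fib (col y k) by [].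
apply: fib_ext => i /=.
suff /(congr1 (fun z : fib c d L => z k)) : Fib (row x i) = Fib (row y i) by [].
by apply: fib_ext => j; apply: xy.
Qed.

Section Evaluation.
Variable L : lmodType R.

Definition fib2_eval n k (x : fib2 a b c d L) : L := x n k.

Lemma fib2_eval_linear n k : linear (fib2_eval n k).
Proof. by []. Qed.

HB.instance Definition _ n k := GRing.isLinear.Build R
  (fib2 a b c d L) L _ (fib2_eval n k) (fib2_eval_linear n k).

End Evaluation.

Variables M N : lmodType R.
Local Notation T := (tensor (fib a b M) (fib c d N)).
Local Notation D := (fib2 a b c d (tensor M N)).

Lemma fib_pure_subproof (x : fib a b M) (y : fib c d N) :
  (fun n k => pure (x n) (y k)) \in fib2_pred a b c d (L := tensor M N).
Proof.
apply/asboolP => n k; rewrite !fibP.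
by rewrite linearDl linearDr !linearZl_LR !linearZr_LR.
Qed.

Definition fib_pure x y : D := Fib2 (fib_pure_subproof x y).

Lemma fib_pure_bilinear : bilinear_for *:%R *:%R fib_pure.
Proof.
split=> [y r x x'|x r y y']; apply/val_inj/funext => n; apply/funext => k.
  exact: linearPl.
exact: linearPr.
Qed.

HB.instance Definition _ := bilinear_isBilinear.Build R
  (fib a b M) (fib c d N) D *:%R *:%R fib_pure fib_pure_bilinear.

Definition fib_tensor : {linear T -> D} := tensor_lift fib_pure.

Lemma fib_tensor_pure x y n k : fib_tensor (pure x y) n k = pure (x n) (y k).
Proof. by rewrite [fib_tensor _]tensor_liftE. Qed.

(** The entry [z i j] need not be a pure tensor, so it is propagated in both directions at once by
    [tensor_map]. *)
Definition fib_tensor_inv (z : D) : T :=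
  \sum_(i < 2) \sum_(j < 2)
     tensor_map (@fib_prop _ a b M i) (@fib_prop _ c d N j) (z i j).

Lemma fib_tensor_inv_linear : linear fib_tensor_inv.
Proof.
move=> r x y; rewrite /fib_tensor_inv scaler_sumr -big_split.
apply: eq_bigr => i _; rewrite scaler_sumr -big_split.
apply: eq_bigr => j _.
by rewrite -[(r *: x + y) i j]/(r *: x i j + y i j) linearP.
Qed.

HB.instance Definition _ :=
  GRing.isLinear.Build R D T _ fib_tensor_inv fib_tensor_inv_linear.

(** Both sides are linear in [u]; on a pure tensor one scalar comes out of each factor. *)
Lemma fib_tensor_prop (i j n k : nat) (u : tensor M N) :
  fib_tensor (tensor_map (@fib_prop _ a b M i) (@fib_prop _ c d N j) u) n k =
    (fib_unit_seq a b i n * fib_unit_seq c d j k) *: u.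
Proof.
pose e := fib_unit_seq a b i n * fib_unit_seq c d j k.
pose f : {linear tensor M N -> tensor M N} :=
  fib2_eval n k \o fib_tensor \o tensor_map (@fib_prop _ a b M i) (@fib_prop _ c d N j).
rewrite -/e -[LHS]/(f u); apply: (@tensor_linear_ext _ _ _ _ f ( *:%R e)) => x y.
rewrite /f /= tensor_mapE /fib2_eval fib_tensor_pure /=.
by rewrite linearZl_LR linearZr_LR /= scalerA.
Qed.

(** On [pure x y], decomposing [x] and [y] by [fib_decomp] and expanding bilinearly yields exactly
    the double sum of [fib_tensor_inv]. *)
Lemma fib_tensorK : cancel fib_tensor fib_tensor_inv.
Proof.
apply: (@tensor_linear_ext _ _ _ _ (fib_tensor_inv \o fib_tensor) idfun) => x y /=.
rewrite -[in RHS](fib_decomp x) -[in RHS](fib_decomp y) linear_sumlz.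
apply: eq_bigr => i _; rewrite linear_sumr; apply: eq_bigr => j _.
by rewrite fib_tensor_pure tensor_mapE.
Qed.

(** By [fib2_ext] it suffices to compare the four initial entries. At [(i, j)] the coefficients of
    [fib_tensor_prop] are products of Kronecker deltas, so a single summand survives. *)
Lemma fib_tensor_invK : cancel fib_tensor_inv fib_tensor.
Proof.
move=> z; apply: fib2_ext => i j; rewrite -[LHS]/(fib2_eval i j _).
rewrite (linear_sum fib_tensor) linear_sum (bigD1 i) //=.
rewrite [X in _ + X]big1 ?addr0 => [|i' /negPf ii'].
  rewrite (linear_sum fib_tensor) linear_sum (bigD1 j) //=.
  rewrite [X in _ + X]big1 ?addr0 => [|j' /negPf jj'].
    by rewrite /fib2_eval fib_tensor_prop !fib_unit_seqE !eqxx mulr1 scale1r.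
  by rewrite /fib2_eval fib_tensor_prop !fib_unit_seqE jj' mulr0 scale0r.
rewrite (linear_sum fib_tensor) linear_sum big1 // => j' _.
by rewrite /= /fib2_eval fib_tensor_prop !fib_unit_seqE ii' mul0r scale0r.
Qed.

Lemma fib_tensor_hshift u :
  fib_tensor (@tensor_hshift R a b c d M N u) = hshift (fib_tensor u).
Proof.
apply: (@tensor_linear_ext _ _ _ _ (fib_tensor \o @tensor_hshift _ a b c d M N)
  (@hshift _ a b c d (tensor M N) \o fib_tensor)) => x y.
apply/val_inj/funext => n; apply/funext => k /=.
by rewrite tensor_mapE !fib_tensor_pure.
Qed.

Lemma fib_tensor_vshift u :
  fib_tensor (@tensor_vshift R a b c d M N u) = vshift (fib_tensor u).
Proof.
apply: (@tensor_linear_ext _ _ _ _ (fib_tensor \o @tensor_vshift _ a b c d M N)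
  (@vshift _ a b c d (tensor M N) \o fib_tensor)) => x y.
apply/val_inj/funext => n; apply/funext => k /=.
by rewrite tensor_mapE !fib_tensor_pure.
Qed.

(** The same function between the [hvmod] aliases, where linearity is over [{mpoly R[2]}]. *)
Definition fib_tensorHV :
    tensor_fibHV a b c d M N -> fib2HV a b c d (tensor M N) :=
  fib_tensor.

Lemma fib_tensorHV_linear : linear fib_tensorHV.
Proof. exact: (@hvmod_linear _ _ _ _ _ _ _ (@tensor_hvshiftC R a b c d M N)
  (@hvshiftC R a b c d (tensor M N)) fib_tensor fib_tensor_hshift fib_tensor_vshift). Qed.

HB.instance Definition _ :=
  GRing.isLinear.Build {mpoly R[2]} (tensor_fibHV a b c d M N)
    (fib2HV a b c d (tensor M N)) _ fib_tensorHV fib_tensorHV_linear.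

End TensorToDouble.

(** On [pure x y], both sides have [(n, k)] entry [pure (f (x n)) (g (y k))]. *)
Lemma fib_tensor_natural (R : comNzRingType) (a b c d : R)
    (M M' N N' : lmodType R) (f : {linear M -> M'}) (g : {linear N -> N'})
    (u : tensor (fib a b M) (fib c d N)) :
  fib_tensor a b c d M' N' (tensor_map (fib_map f) (fib_map g) u) =
  fib2_map (tensor_map f g) (fib_tensor a b c d M N u).
Proof.
apply: (@tensor_linear_ext _ _ _ _
  (@fib_tensor _ a b c d M' N' \o tensor_map (@fib_map _ a b _ _ f) (@fib_map _ c d _ _ g))
  (@fib2_map _ a b c d _ _ (tensor_map f g) \o @fib_tensor _ a b c d M N)) => x y.
apply/val_inj/funext => n; apply/funext => k /=.
by rewrite tensor_mapE !fib_tensor_pure tensor_mapE.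
Qed.

Theorem proposition1p7 (R : comNzRingType) (a b c d : R) :
  exists phi : forall M N : lmodType R,
      {linear tensor_fibHV a b c d M N -> fib2HV a b c d (tensor M N)},
    (forall M N : lmodType R, bijective (phi M N)) /\
    (forall (M M' N N' : lmodType R) (f : {linear M -> M'})
            (g : {linear N -> N'}) (u : tensor (fib a b M) (fib c d N)),
        phi M' N' (tensor_map (fib_map f) (fib_map g) u) =
        fib2_map (tensor_map f g) (phi M N u)).
Proof.
exists (fun M N => @fib_tensorHV R a b c d M N); split=> [M N|].
  (* The aliases keep their carriers, so the inverse of the [R]-linear map serves unchanged. *)
  by exists (@fib_tensor_inv _ a b c d M N);
    [apply: fib_tensorK | apply: fib_tensor_invK].
exact: fib_tensor_natural.
Qed.
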